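(* Let $p$ be a prime, $\mathcal{O}$ the valuation ring of a finite extension $E$ of $\mathbf{Q}_p$ with uniformizer $\varpi$, and $\mathbf{F}=\mathcal{O}/\varpi\mathcal{O}$. Let $s$ be a positive integer, $n_1,\dots,n_s$ positive integers, $n=\sum_{i=1}^s n_i$, $A_i=\mathcal{O}^{n_i}$ for $1\le i\le s$, and $A=\prod_{i=1}^s A_i=\mathcal{O}^n$, with canonical projections $\varphi_i:A\twoheadrightarrow A_i$. Let $T\subset A$ be a (local complete) $\mathcal{O}$-subalgebra which is of full rank as an $\mathcal{O}$-submodule of $A$, and let $J\subset T$ be an ideal of finite index. Set $T_i=\varphi_i(T)$ and $J_i=\varphi_i(J)$. If $\#\mathbf{F}^\times\ge s-1$ and each $J_i$ is a principal ideal of $T_i$, then $$\#\prod_{i=1}^s T_i/J_i\;\ge\;\#\,T/J.$$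
   Context: Here $A_i=\mathcal{O}^{n_i}$ and $A=\mathcal{O}^n$ are $\mathcal{O}$-algebras with coordinatewise operations, and $\mathcal{O}$-subalgebras contain the identity. $T$ is a complete local ring; each $T_i$ is then also a (local complete) $\mathcal{O}$-subalgebra of $A_i$, the maps $\varphi_i|_T:T\to T_i$ are local homomorphisms, and each $J_i$ is an ideal of finite index in $T_i$. The symbol $\#$ denotes cardinality. *)

(* Defs.v *)
From HB Require Import structures.
From mathcomp Require Import all_boot all_order all_algebra all_field.
From mathcomp Require Import boolp classical_sets functions cardinality reals.

Set Implicit Arguments.
Unset Strict Implicit.
Unset Printing Implicit Defensive.
Import Order.TTheory GRing.Theory Num.Theory.
Local Open Scope classical_set_scope.
Local Open Scope ring_scope.

Record absval (R : realType) (K : fieldType) := Absval {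
  absval_fun :> K -> R;
  absval_ge0 : forall x, 0 <= absval_fun x;
  absval_eq0 : forall x, absval_fun x = 0 <-> x = 0;
  absvalM : forall x y, absval_fun (x * y) = absval_fun x * absval_fun y;
  absval_ultra : forall x y,
    absval_fun (x + y) <= Num.max (absval_fun x) (absval_fun y) }.

(* |x|_p = p^(v_p(denominator) - v_p(numerator)), so that |p|_p = 1/p. *)
Definition padic_absval_rat (R : realType) (p : nat) (x : rat) : R :=
  if x == 0 then 0
  else p%:R ^+ logn p `|denq x|%N / p%:R ^+ logn p `|numq x|%N.

Section Completeness.
Variables (R : realType) (K : fieldType) (v : absval R K).

Definition absval_cauchy (u : nat -> K) : Prop :=
  forall e : R, 0 < e ->
    exists N, forall m n, (N <= m)%N -> (N <= n)%N -> v (u m - u n) < e.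

Definition absval_converges (u : nat -> K) (l : K) : Prop :=
  forall e : R, 0 < e -> exists N, forall n, (N <= n)%N -> v (u n - l) < e.

Definition absval_complete : Prop :=
  forall u, absval_cauchy u -> exists l, absval_converges u l.

End Completeness.

(* Q_p, up to unique isomorphism of valued fields: a completion of the
   rationals for the p-adic absolute value. *)
Definition is_padic_field (R : realType) (p : nat) (Qp : fieldType)
    (v : absval R Qp) : Prop :=
  [/\ forall x : rat, v (ratr x) = padic_absval_rat R p x,
      forall (x : Qp) (e : R), 0 < e -> exists q : rat, v (x - ratr q) < e
    & absval_complete v].

(* On a finite extension E of Q_p there is exactly one such w. *)
Definition absval_extends (R : realType) (Qp : fieldType) (v : absval R Qp)
    (E : fieldExtType Qp) (w : absval R E) : Prop :=
  forall a : Qp, w a%:A = v a.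

Section ValuationRing.
Variables (R : realType) (K : fieldType) (w : absval R K).

Definition valring_pred : {pred K} := fun x => w x <= 1.

Lemma absval1 : w 1 = 1.
Proof.
have w1n0 : w 1 != 0.
  by apply/eqP => /absval_eq0/eqP; rewrite oner_eq0.
by apply: (mulfI w1n0); rewrite mulr1 -absvalM mulr1.
Qed.

Lemma absvalN1 : w (-1) = 1.
Proof.
apply/eqP; rewrite -[_ == _](@eqrXn2 _ 2) ?absval_ge0 ?ler01 //.
by rewrite expr1n expr2 -absvalM mulrNN mulr1 absval1.
Qed.

Fact valring_subring_closed : subring_closed valring_pred.
Proof.
split=> [|x y|x y]; rewrite !unfold_in.
- by rewrite absval1.
- move=> wx wy; apply: le_trans (absval_ultra _ _ _) _.
  by rewrite ge_max wx -mulN1r absvalM absvalN1 mul1r.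
- by move=> wx wy; rewrite absvalM mulr_ile1 ?absval_ge0.
Qed.

HB.instance Definition _ :=
  GRing.isSubringClosed.Build K valring_pred valring_subring_closed.

Record valring := Valring { valring_val : K; _ : valring_val \in valring_pred }.

HB.instance Definition _ := [isSub for valring_val].
HB.instance Definition _ := [Choice of valring by <:].
HB.instance Definition _ := [SubChoice_isSubComNzRing of valring by <:].

(* pi generates the maximal ideal of the valuation ring. *)
Definition uniformizer (pi : valring) : Prop :=
  forall x : valring, w (val x) < 1 <-> exists y, x = pi * y.

End ValuationRing.

(* Subrings and ideals are carried as subsets of an ambient ring A. *)
Section Subsets.
Variable A : pzRingType.
Implicit Types (T I J m : set A).

Definition is_ideal T J : Prop :=
  [/\ J `<=` T, J 0,
      forall x y, J x -> J y -> J (x + y)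
    & forall t x, T t -> J x -> J (t * x)].

Definition principal_ideal T a : set A := [set t * a | t in T].

Definition is_principal T J : Prop :=
  exists2 a, T a & J = principal_ideal T a.

Definition coset J (x : A) : set A := [set x + j | j in J].

Definition quot T J : set (set A) := [set coset J x | x in T].

Definition quot_units T J : set (set A) :=
  [set coset J x | x in [set x | T x /\ exists2 y, T y & J (x * y - 1)]].

Definition finite_index T J : Prop := finite_set (quot T J).

Definition is_maximal T m : Prop :=
  [/\ is_ideal T m, m != T
    & forall I, is_ideal T I -> m `<=` I -> I = m \/ I = T].

Definition ideal_mul I J : set A :=
  [set x | exists r (a b : 'I_r -> A),
     [/\ forall k, I (a k), forall k, J (b k) & x = \sum_k a k * b k]].

Fixpoint ideal_exp T m (k : nat) : set A :=
  if k is k'.+1 then ideal_mul m (ideal_exp T m k') else T.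

(* Bijectivity of the canonical map from T to the inverse limit of T/m^k. *)
Definition adic_complete T m : Prop :=
  (forall x, (forall k, ideal_exp T m k x) -> x = 0) /\
  (forall u : nat -> A, (forall k, T (u k)) ->
     (forall k, ideal_exp T m k (u k.+1 - u k)) ->
     exists2 l, T l & forall k, ideal_exp T m k (l - u k)).

Definition complete_local T : Prop :=
  exists m, [/\ is_maximal T m, forall m', is_maximal T m' -> m' = m
              & adic_complete T m].

End Subsets.

(* The algebra O^d with coordinatewise operations; O^o is the module O, so that
   c *: x makes sense for a scalar c in O. *)
Notation coord_alg O d := {ffun 'I_d -> O^o}.

Section CoordinatewiseAlgebra.
Variables (O : comNzRingType) (d : nat).
Local Notation A := (coord_alg O d).

Definition is_subalgebra (T : set A) : Prop :=
  [/\ T 1,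
      forall (c : O) x y, T x -> T y -> T (c *: x + y)
    & forall x y, T x -> T y -> T (x * y)].

Definition lin_indep (r : nat) (b : 'I_r -> A) : Prop :=
  forall c : 'I_r -> O, \sum_k c k *: b k = 0 -> forall k, c k = 0.

Definition has_rank (T : set A) (r : nat) : Prop :=
  (exists b : 'I_r -> A, (forall k, T (b k)) /\ lin_indep b) /\
  (forall r' (b : 'I_r' -> A),
     (forall k, T (b k)) -> lin_indep b -> (r' <= r)%N).

Definition full_rank (T : set A) : Prop := has_rank T d.

End CoordinatewiseAlgebra.

(* The i-th projection of O^(n_0 + ... + n_(s-1)) = \prod_i O^(n_i):
   tagnat.Rank i j is the position of the j-th coordinate of the i-th block. *)
Definition block_proj (O : comNzRingType) (s : nat) (n : 'I_s -> nat)
    (i : 'I_s) (a : coord_alg O (\sum_(k < s) n k)) : coord_alg O (n i) :=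
  [ffun j => a (tagnat.Rank i j)].

(* Main.v *)
Require Import Defs.
From mathcomp Require Import all_boot all_order all_algebra all_field.
From mathcomp Require Import finmap ring lra.
From mathcomp Require Import boolp classical_sets functions cardinality reals.
Import Order.TTheory GRing.Theory Num.Theory.
Local Open Scope classical_set_scope.
Local Open Scope card_scope.
Local Open Scope ring_scope.

(** Write phi_i for the projection to the i-th block and A for O^n. The proof
    replaces J by a principal ideal of T generated by a single element a of J
    whose projections generate all the phi_i(J) at once, and then compares two
    indices of multiplication by a.

    Existence of a ([simultaneous_generator]). Let b_i in J project to a
    generator of phi_i(J), and let c_i be a coordinate in the i-th block. An
    element x of J satisfies phi_i(x) = phi_i(t b_i) with t in T, so
    |x(c_i)| <= |b_i(c_i)|. Equality means that t(c_i) is a unit of O, and then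
    t is a unit of T because T is local ([local_unit]), so that phi_i(x)
    generates phi_i(J) too. Thus a must avoid s proper subspaces of J modulo
    the maximal ideal; since the residue field F has at least s elements, a
    pencil argument finds a by treating the blocks one after the other
    ([simultaneous_maximum]). Finite index of J makes every coordinate of a
    nonzero ([finite_index_regular]).

    Comparison of indices ([quot_card_le]). Let B be the product of the
    phi_i(T), a subring of A that contains T. As T has full rank, eA is
    contained in T for some nonzero e in O ([full_rank_conductor]), and A/eaA
    is finite ([coord_cover]), so all indices below are finite. Multiplication
    by a is injective, hence [aB : aT] = [B : T], and

      [B : T] [T : aT] = [B : aT] = [B : aB] [aB : aT] = [B : aB] [B : T],

    so [T : aT] = [B : aB] ([index_mul_stable]). Now #T/J <= [T : aT] because
    J contains aT, and B/aB is the product of the T_i/J_i because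
    phi_i(J) = phi_i(aT) for all i.

    Finiteness of F is read off from T/J: if J <> T then J lies in the maximal
    ideal of T, so F is a quotient of T/J ([finite_index_residue_cover]). The
    case J = T is trivial. *)

(** * Indices of additive subgroups *)

Section CosetRepresentatives.
Set Implicit Arguments.
Unset Strict Implicit.
Variable A : pzRingType.
Implicit Types G H K : set A.

Definition subgroup_set G : Prop := G 0 /\ forall x y, G x -> G y -> G (x - y).

(** Representatives are indexed by a finite type, so that a finite index is the
    cardinal of that type and indices can be multiplied and cancelled. *)
Definition coset_reps G H (I : finType) (f : I -> A) : Prop :=
  [/\ forall i, G (f i), forall i j, H (f i - f j) -> i = j
    & forall x, G x -> exists i, H (x - f i)].

Lemma subgroup_setN G x : subgroup_set G -> G x -> G (- x).
Proof. by move=> [G0 GB] Gx; rewrite -[- x]add0r; apply: GB. Qed.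

Lemma subgroup_setD G x y : subgroup_set G -> G x -> G y -> G (x + y).
Proof.
by move=> sG Gx Gy; rewrite -[y]opprK; apply: sG.2 => //; apply: subgroup_setN.
Qed.

Lemma coset_eqP H x y : subgroup_set H -> coset H x = coset H y <-> H (x - y).
Proof.
move=> sH; split=> [exy|hxy].
  have : coset H y x by rewrite -exy; exists 0; [exact: sH.1|rewrite addr0].
  by move=> [j Hj <-]; rewrite addrAC subrr add0r.
apply/seteqP; split=> _ [j Hj <-].
  by exists (x - y + j); [exact: subgroup_setD|rewrite addrA (addrC y) subrK].
exists (j - (x - y)); first exact: sH.2.
by rewrite addrCA opprB (addrC x) subrK addrC.
Qed.

Lemma coset_reps_card_le G H (I J : finType) (f : I -> A) (g : J -> A) :
  subgroup_set H -> coset_reps G H f -> coset_reps G H g -> (#|I| <= #|J|)%N.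
Proof.
move=> sH [fG fH _] [_ _ gc].
have [h hP] := choice (fun i => gc _ (fG i)).
apply: (@leq_card _ _ h) => i j hij; apply: fH.
have := sH.2 _ _ (hP i) (hP j).
by rewrite hij opprB addrA subrK.
Qed.

Lemma coset_reps_card G H (I J : finType) (f : I -> A) (g : J -> A) :
  subgroup_set H -> coset_reps G H f -> coset_reps G H g -> #|I| = #|J|.
Proof.
move=> sH tf tg; apply/eqP.
by rewrite eqn_leq (coset_reps_card_le sH tf tg) (coset_reps_card_le sH tg tf).
Qed.

(** Multiplicativity of the index: adding representatives of H/K to those of G/H
    hits every coset of K in G exactly once. *)
Lemma coset_reps_tower G H K (I J : finType) (f : I -> A) (g : J -> A) :
  subgroup_set G -> subgroup_set H -> H `<=` G -> K `<=` H ->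
  coset_reps G H f -> coset_reps H K g ->
  coset_reps G K (fun ij : I * J => f ij.1 + g ij.2).
Proof.
move=> sG sH HG KH [fG fH fc] [gH gK gc]; split.
- by move=> [i j] /=; apply: subgroup_setD => //; apply: HG.
- move=> [i j] [i' j'] /= kij.
  have ii' : i = i'.
    apply: fH; rewrite -(addrK (g j - g j') (_ - _)).
    by apply: sH.2; [rewrite addrACA -opprD; exact: KH|exact: sH.2].
  rewrite -ii' in kij *; congr pair; apply: gK.
  by move: kij; rewrite opprD addrACA subrr add0r.
- move=> x Gx; have [i Hi] := fc _ Gx; have [j Kj] := gc _ Hi.
  by exists (i, j) => /=; rewrite opprD addrA.
Qed.

Lemma coset_reps_image G H (I : finType) (f : I -> A) (h : A -> A) :
  injective h -> {morph h : x y / x - y} ->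
  coset_reps G H f -> coset_reps (h @` G) (h @` H) (h \o f).
Proof.
move=> hinj hB [fG fH fc]; split.
- by move=> i; exists (f i).
- by move=> i j [x Hx]; rewrite /= -hB => /hinj xE; apply: fH; rewrite -xE.
- move=> _ [x Gx <-]; have [i Hi] := fc _ Gx; exists i.
  by exists (x - f i) => //=; rewrite hB.
Qed.

Lemma finite_quot_reps G H : subgroup_set H -> finite_set (quot G H) ->
  exists (J : finType) (g : J -> A), coset_reps G H g.
Proof.
move=> sH fin.
have rP (C : fset_set (quot G H)) : exists x, G x /\ coset H x = val C.
  case: C => C /=; rewrite in_fset_set// => /set_mem[x Gx <-]; by exists x.
have [g gP] := choice rP.
exists (fset_set (quot G H) : finType), g; split.
- by move=> C; case: (gP C).
- move=> C D /coset_eqP; rewrite (gP C).2 (gP D).2 => /(_ sH).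
  exact: val_inj.
- move=> x Gx; have Cx : coset H x \in fset_set (quot G H).
    by rewrite in_fset_set//; apply: mem_set; exists x.
  by exists [` Cx]%fset; apply/coset_eqP; rewrite // (gP _).2.
Qed.

Lemma cover_finite_quot G H (I : finType) (f : I -> A) : subgroup_set H ->
  (forall x, G x -> exists i, H (x - f i)) -> finite_set (quot G H).
Proof.
move=> sH fc; apply: (@sub_finite_set _ _ ((fun i => coset H (f i)) @` setT)).
  move=> _ [x Gx <-]; have [i Hi] := fc _ Gx.
  by exists i => //; apply/esym/coset_eqP.
by apply: finite_image; exact: finite_finset.
Qed.

End CosetRepresentatives.

Section Index.
Set Implicit Arguments.
Unset Strict Implicit.

(** Both sides of [B : T] [T : hT] = [B : hT] = [B : hB] [hB : hT] contain the
    factor [B : T], because h is injective and thus [hB : hT] = [B : T].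
    Cancelling it leaves [T : hT] = [B : hB]. *)
Lemma index_mul_stable (A : pzRingType) (T B : set A) (h : A -> A)
    (I J K : finType) (f : I -> A) (g : J -> A) (k : K -> A) :
    injective h -> {morph h : x y / x - y} ->
    subgroup_set T -> subgroup_set B ->
    T `<=` B -> h @` T `<=` T -> h @` B `<=` B ->
    coset_reps B T f -> coset_reps T (h @` T) g ->
    coset_reps B (h @` B) k -> #|J| = #|K|.
Proof.
move=> hinj hB sT sB TB hTT hBB tf tg tk.
have h0 : h 0 = 0 by have := hB 0 0; rewrite !subrr.
have sh G : subgroup_set G -> subgroup_set (h @` G).
  move=> [G0 GB]; split; first by exists 0.
  by move=> _ _ [x Gx <-] [y Gy <-]; exists (x - y); [exact: GB|rewrite hB].
have := coset_reps_card (sh _ sT) (coset_reps_tower sB sT TB hTT tf tg)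
  (coset_reps_tower sB (sh _ sB) hBB (image_subset h TB) tk
     (coset_reps_image hinj hB tf)).
rewrite !card_prod mulnC => /eqP; rewrite eqn_pmul2r => [/eqP//|].
by apply/card_gt0P; case: tf => _ _ /(_ 0 sB.1)[i _]; exists i.
Qed.

(** A comparison through an index type: passing to I and back costs no choice of
    an index for each element of S. *)
Lemma card_le_through (I X Y : Type) (S : set X) (S' : set Y)
    (f : I -> X) (g : I -> Y) :
    S `<=` range f -> injective g -> (forall i, S' (g i)) -> S #<= S'.
Proof.
move=> Sf ginj gS'; apply: card_le_trans (subset_card_le Sf) _.
apply: card_le_trans (card_image_le _ _) _.
have /card_eqPle[_ /card_le_trans] : range g #= [set: I].
  by apply: inj_card_eq => x y _ _; exact: ginj.
by apply; apply: subset_card_le => _ [i _ <-].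
Qed.

End Index.

(** * The valuation ring and its coordinate algebras *)

Section ValuationRing.
Set Implicit Arguments.
Unset Strict Implicit.
Variables (R : realType) (K : fieldType) (w : absval R K).
Local Notation O := (valring w).
Implicit Types x y : O.

Lemma absvalN (a : K) : w (- a) = w a.
Proof. by rewrite -mulN1r absvalM absvalN1 mul1r. Qed.

Lemma absvalX (a : K) k : w (a ^+ k) = w a ^+ k.
Proof.
by elim: k => [|k IHk]; rewrite ?expr0 ?absval1// !exprS absvalM IHk.
Qed.

Lemma absval_gt0 (a : K) : (0 < w a) = (a != 0).
Proof.
rewrite lt_neqAle absval_ge0 andbT eq_sym; congr (~~ _).
by apply/eqP/eqP => [/absval_eq0 //|->]; apply/absval_eq0.
Qed.

Lemma absvalB_lt (a b : K) e : w a < e -> w b < e -> w (a - b) < e.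
Proof.
move=> ha hb; apply: le_lt_trans (absval_ultra _ _ _) _.
by rewrite gt_max absvalN ha.
Qed.

Lemma valring_le1 x : w (val x) <= 1. Proof. exact: (valP x). Qed.

Lemma valring_neq0 x : (val x != 0) = (x != 0).
Proof. by rewrite -(inj_eq val_inj) raddf0. Qed.

Lemma valring_absvalM x y : w (val (x * y)) = w (val x) * w (val y).
Proof. by rewrite rmorphM absvalM. Qed.

Lemma valring_absvalB_lt x y e :
  w (val x) < e -> w (val y) < e -> w (val (x - y)) < e.
Proof. by move=> hx hy; rewrite raddfB; apply: absvalB_lt. Qed.

Lemma valring_mulf_neq0 x y : x != 0 -> y != 0 -> x * y != 0.
Proof. by rewrite -!valring_neq0 rmorphM /= => ? ?; rewrite mulf_neq0. Qed.

Lemma valring_mulfI x : x != 0 -> injective ( *%R x).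
Proof.
move=> x0 y z /(congr1 val); rewrite !rmorphM /= => /mulfI/val_inj.
by apply; rewrite valring_neq0.
Qed.

Lemma valring_dvd x y : w (val x) <= w (val y) -> exists z, x = y * z.
Proof.
have [->|y0] := eqVneq y 0.
  rewrite raddf0 (absval_eq0 _ 0).2// => x0; exists 0; rewrite mulr0.
  apply/val_inj; rewrite raddf0; apply/(absval_eq0 w)/le_anti.
  by rewrite x0 absval_ge0.
have vy : 0 < w (val y) by rewrite absval_gt0 valring_neq0.
move=> xy; have zP : val x / val y \in valring_pred w.
  rewrite unfold_in absvalM -(ler_pM2r vy) -mulrA -absvalM.
  by rewrite mulVf ?valring_neq0// absval1 mulr1 mul1r.
exists (Valring zP); apply: val_inj; rewrite rmorphM /= mulrC divfK//.
Qed.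

Lemma valring_unit x : w (val x) = 1 -> exists y, x * y = 1.
Proof.
move=> x1; have [|y ->] := @valring_dvd 1 x; last by exists y.
by rewrite x1 rmorph1 absval1.
Qed.

(** Writing a = 1 - h with h > 0, Bernoulli gives a^N (1 + N h) <= 1, so any N
    with e N h >= 1 works. *)
Lemma expr_vanish (a e : R) : 0 <= a < 1 -> 0 < e -> exists N, a ^+ N <= e.
Proof.
move=> /andP[a0 a1] e0; pose h := 1 - a.
have h0 : 0 < h by rewrite subr_gt0.
have bernoulli N : a ^+ N * (1 + N%:R * h) <= 1.
  elim: N => [|N IHN]; first by rewrite expr0 mul0r addr0 mulr1.
  apply: le_trans IHN; rewrite exprSr -mulrA ler_wpM2l ?exprn_ge0//.
  rewrite -natr1 -subr_ge0 (_ : _ - _ = (N%:R + 1) * h ^+ 2).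
    by rewrite mulr_ge0 ?exprn_ge0 ?ltW// natr1.
  by rewrite /h; ring.
exists (Num.bound (e * h)^-1); set N := Num.bound _.
have eh0 : 0 < e * h by rewrite mulr_gt0.
have hN : (e * h)^-1 < N%:R by rewrite archi_boundP// invr_ge0 ltW.
have eN : 1 < e * (1 + N%:R * h).
  have : 1 < N%:R * (e * h) by rewrite -ltr_pdivrMr// mul1r.
  by nra.
have pos : 0 < 1 + N%:R * h by rewrite ltr_pwDl// mulr_ge0 ?ltW.
by rewrite -(ler_pM2r pos); apply: le_trans (bernoulli N) (ltW eN).
Qed.

Lemma uniformizer_lt1 (pi : O) : uniformizer pi -> w (val pi) < 1.
Proof. by move=> /(_ pi)[_]; apply; exists 1; rewrite mulr1. Qed.

(** Divisibility in O is comparison of absolute values, and the powers of |pi|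
    < 1 drop below |x| > 0. *)
Lemma dvd_uniformizer_exp (pi x : O) : uniformizer pi -> x != 0 ->
  exists N z, pi ^+ N = x * z.
Proof.
move=> /uniformizer_lt1 pi1 x0.
have [||N hN] := @expr_vanish (w (val pi)) (w (val x)).
- by rewrite absval_ge0.
- by rewrite absval_gt0 valring_neq0.
by exists N; apply: valring_dvd; rewrite rmorphXn absvalX.
Qed.

(** Expansion in pi-adic digits: with finitely many digits l modulo pi, the sums
    of N digits times powers of pi represent all residues modulo pi^N. *)
Lemma uniformizer_exp_cover (pi : O) (I : finType) (l : I -> O) :
    uniformizer pi -> (forall x, exists i, w (val (x - l i)) < 1) ->
  forall N, exists (J : finType) (f : J -> O),
    forall x, exists j y, x - f j = pi ^+ N * y.
Proof.
move=> hpi lc; elim=> [|N [J [f fc]]].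
  by exists unit, (fun=> 0) => x; exists tt, x; rewrite subr0 mul1r.
exists (I * J)%type, (fun ij => l ij.1 + pi * f ij.2) => x.
have [i /hpi[y xy]] := lc x; have [j [z yz]] := fc y.
exists (i, j), z => /=.
by rewrite opprD addrA xy -mulrBr yz exprS mulrA.
Qed.

Lemma coord_mulE d (x y : coord_alg O d) c : (x * y) c = x c * y c :> O.
Proof. by rewrite ffunE. Qed.

Lemma coord_scaleE d (a : O) (x : coord_alg O d) c :
  (a *: x) c = a * (x c : O) :> O.
Proof. by rewrite ffunE. Qed.

Lemma coord_addE d (x y : coord_alg O d) c : (x + y) c = x c + y c :> O.
Proof. by rewrite ffunE. Qed.

Lemma coord_subE d (x y : coord_alg O d) c : (x - y) c = x c - y c :> O.
Proof. by rewrite !ffunE. Qed.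

Lemma coord_scale1E d (a : O) c : (a *: (1 : coord_alg O d)) c = a :> O.
Proof. by rewrite coord_scaleE ffunE mulr1. Qed.

Lemma coord_mulC d (x y : coord_alg O d) : x * y = y * x.
Proof. by apply/ffunP => c; rewrite !coord_mulE; exact: (@mulrC O). Qed.

Lemma coord_mulI d (e : coord_alg O d) :
  (forall c, e c != 0 :> O) -> injective ( *%R e).
Proof.
move=> e0 x y /ffunP exy; apply/ffunP => c.
by have := exy c; rewrite !coord_mulE => /(valring_mulfI (e0 c)).
Qed.

(** Finiteness of O^d / e O^d. A single power of pi is a multiple of every
    coordinate of e, so representatives modulo that power, chosen coordinate by
    coordinate, suffice. *)
Lemma coord_cover (pi : O) (I : finType) (l : I -> O) d (e : coord_alg O d) :
    uniformizer pi -> (forall x, exists i, w (val (x - l i)) < 1) ->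
    (forall c, e c != 0 :> O) ->
  exists (J : finType) (f : J -> coord_alg O d),
    forall x : coord_alg O d, exists j (y : coord_alg O d), x - f j = e * y.
Proof.
move=> hpi lc e0.
have /choice[N Ne] := fun c => dvd_uniformizer_exp hpi (e0 c).
pose M := (\sum_c N c)%N.
have [J [f fc]] := uniformizer_exp_cover hpi lc M.
exists {ffun 'I_d -> J},
  (fun g : {ffun 'I_d -> J} => [ffun c => f (g c) : O^o]) => x.
have /choice[g gP] := fun c => fc (x c).
have dvd c : exists y, (x c : O) - f (g c) = (e c : O) * y.
  have [y ->] := gP c; have [z ez] := Ne c.
  exists (z * (pi ^+ (M - N c) * y)); rewrite mulrA -ez mulrA -exprD subnKC//.
  by rewrite /M (bigD1 c)//= leq_addr.
have [y yP] := choice dvd.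
exists [ffun c => g c], [ffun c => y c : O^o]; apply/ffunP => c.
by rewrite coord_mulE !ffunE; exact: yP.
Qed.

End ValuationRing.

Section Padic.
Set Implicit Arguments.
Unset Strict Implicit.

(** The absolute value of p in E is 1/p, so p is a nonzero element of the
    maximal ideal, hence a nonzero multiple of pi. *)
Lemma padic_uniformizer_neq0 (R : realType) (p : nat) (Qp : fieldType)
    (v : absval R Qp) (E : fieldExtType Qp) (w : absval R E) (pi : valring w) :
  prime p -> is_padic_field p v -> absval_extends v w -> uniformizer pi ->
  pi != 0.
Proof.
move=> p_pr [vrat _ _] hw hpi.
have p0 : 0 < (p%:R : R) by rewrite ltr0n prime_gt0.
have wp : w p%:R = p%:R^-1.
  have -> : p%:R = (p%:R : Qp)%:A :> E by rewrite scaler_nat.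
  rewrite hw; have := vrat p%:R; rewrite ratr_nat => ->.
  rewrite /padic_absval_rat pnatr_eq0 eqn0Ngt prime_gt0//=.
  have -> : (p%:R : rat) = p%:Z%:Q by [].
  rewrite numq_int denq_int.
  by rewrite !absz_nat logn1 expr0 logn_prime// eqxx expr1 mul1r.
have pP : p%:R \in valring_pred w.
  by rewrite unfold_in wp invf_le1// ler1n prime_gt0.
apply/eqP => pi0.
have [] := (hpi (Valring pP)).1.
  by rewrite /= wp invf_lt1// ltr1n prime_gt1.
move=> y; rewrite pi0 mul0r => /(congr1 val).
rewrite raddf0 /= => /(absval_eq0 w).
by rewrite wp => /eqP; rewrite invr_eq0 gt_eqF.
Qed.

End Padic.

(** * Full-rank and local subalgebras *)

Section Subalgebras.
Set Implicit Arguments.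
Unset Strict Implicit.
Variables (O : comNzRingType) (d : nat) (T : set (coord_alg O d)).
Hypothesis hT : is_subalgebra T.

Lemma coord_scale1Ml (c : O) (x : coord_alg O d) :
  (c *: (1 : coord_alg O d)) * x = c *: x.
Proof. by apply/ffunP => i; rewrite !ffunE -scalerAl mul1r. Qed.

Lemma subalg1 : T 1. Proof. by case: hT. Qed.

Lemma subalgM x y : T x -> T y -> T (x * y).
Proof. by case: hT => _ _; apply. Qed.

Lemma subalg0 : T 0.
Proof.
case: hT => T1 TD _; have := TD (-1) 1 1 T1 T1.
by rewrite scaleN1r addNr.
Qed.

Lemma subalg_subgroup : subgroup_set T.
Proof.
case: hT => _ TD _; split=> [|x y Tx Ty]; first exact: subalg0.
by rewrite addrC -scaleN1r; apply: TD.
Qed.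

Lemma subalgZ (c : O) x : T x -> T (c *: x).
Proof. by case: hT => _ TD _ Tx; rewrite -[_ *: _]addr0; apply/TD/subalg0. Qed.

Lemma ideal_subgroup J : is_ideal T J -> subgroup_set J.
Proof.
move=> [_ J0 JD JM]; split=> // x y Jx Jy; apply: JD => //.
rewrite -mulN1r; apply: JM => //.
by apply: (subgroup_setN subalg_subgroup); exact: subalg1.
Qed.

Lemma idealZ J (c : O) x : is_ideal T J -> J x -> J (c *: x).
Proof.
move=> [_ _ _ JM] Jx; rewrite -coord_scale1Ml.
by apply: JM => //; apply: subalgZ; exact: subalg1.
Qed.

End Subalgebras.

Section ValuationSubalgebras.
Set Implicit Arguments.
Unset Strict Implicit.
Variables (R : realType) (K : fieldType) (w : absval R K).
Local Notation O := (valring w).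
Variables (d : nat) (T : set (coord_alg O d)).
Hypothesis hT : is_subalgebra T.

(** If the determinant vanished, a row vector v over K would give a relation
    between the b k. Dividing v by an entry of largest absolute value makes its
    coefficients integral and one of them equal to 1, so the relation is not
    trivial over O either. *)
Lemma lin_indep_det (b : 'I_d -> coord_alg O d) : lin_indep b ->
  \det (\matrix_(k, c) (b k c : O)) != 0.
Proof.
move=> b_free; set M := \matrix_(k, c) _.
rewrite -valring_neq0 -det_map_mx; apply/det0P => -[v /rV0Pn[k1 vk1] vM].
have [k0 _ k0max] : exists2 k0, true & forall k, w (v 0 k) <= w (v 0 k0).
  case: (@arg_maxP _ _ _ k1 predT (fun k => w (v 0 k))) => // k _ kP.
  by exists k => // j; apply: kP.
have vk0 : v 0 k0 != 0.
  by rewrite -(absval_gt0 w); apply: lt_le_trans (k0max k1); rewrite absval_gt0.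
have cP k : v 0 k / v 0 k0 \in valring_pred w.
  have wk0 : 0 < w (v 0 k0) by rewrite absval_gt0.
  rewrite unfold_in -(ler_pM2r wk0) -absvalM divfK// mul1r; exact: k0max.
suff /(_ k0)/(congr1 val) : forall k, Valring (cP k) = 0.
  rewrite raddf0 -[LHS]/(v 0 k0 / v 0 k0) divff// => /eqP.
  by rewrite oner_eq0.
apply: b_free.
apply/ffunP => c; rewrite sum_ffunE ffunE; apply: val_inj.
rewrite raddf0 raddf_sum /=.
transitivity ((v *m map_mx val M) 0 c / v 0 k0); last by rewrite vM mxE mul0r.
rewrite mxE mulr_suml; apply: eq_bigr => k _.
rewrite !mxE !ffunE -[LHS]/(v 0 k / v 0 k0 * val (b k c : O)).
by rewrite mulrAC.
Qed.

(** With M the matrix of a full-rank family in T, \det M *: x is x (\adj M) M,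
    an O-combination of the rows of M. *)
Lemma full_rank_conductor : full_rank T ->
  exists2 e : O, e != 0 & forall x, T (e *: x).
Proof.
move=> [[b [Tb b_free]] _]; pose M := \matrix_(k, c) (b k c : O).
exists (\det M) => [|x]; first exact: lin_indep_det.
pose y := (\row_c (x c : O)) *m \adj M.
have -> : \det M *: x = \sum_k y 0 k *: b k.
  apply/ffunP => c; transitivity ((y *m M) 0 c).
    by rewrite -mulmxA mul_adj_mx mul_mx_scalar !mxE !ffunE.
  by rewrite mxE sum_ffunE; apply: eq_bigr => k _; rewrite !mxE !ffunE.
elim/big_ind: _ => [|u v|k _]; first exact: subalg0.
  exact: (subgroup_setD (subalg_subgroup hT)).
exact: subalgZ.
Qed.

Definition coord_kernel (c : 'I_d) : set (coord_alg O d) :=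
  [set t | T t /\ w (val (t c : O)) < 1].

(** An element x of T outside the kernel has a unit c-th coordinate, with
    inverse y say; then 1 - y *: x lies in the kernel, because the scalars
    belong to T. *)
Lemma coord_kernel_maximal c : is_maximal T (coord_kernel c).
Proof.
have kid : is_ideal T (coord_kernel c).
  split=> [x []//| |x y [Tx wx] [Ty wy]|t x Tt [Tx wx]].
  - split; first exact: subalg0.
    by rewrite ffunE raddf0 (absval_eq0 _ _).2.
  - split; first exact: (subgroup_setD (subalg_subgroup hT)).
    rewrite ffunE raddfD /=; apply: le_lt_trans (absval_ultra _ _ _) _.
    by rewrite gt_max wx.
  - split; first exact: subalgM.
    rewrite coord_mulE valring_absvalM.
    by apply: le_lt_trans wx; rewrite ler_piMl ?absval_ge0 ?valring_le1.
split=> //.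
  apply/eqP => /seteqP[_ /(_ 1 (subalg1 hT))[_]].
  by rewrite ffunE rmorph1 absval1 ltxx.
move=> I hI kI.
have [[x Ix nkx]|nI] := pselect (exists2 x, I x & ~ coord_kernel c x).
  right; apply/seteqP; split; first by case: hI.
  have Tx : T x by case: hI => + _ _ _; apply.
  have [y xy] : exists y, (x c : O) * y = 1.
    apply: valring_unit; apply: le_anti; rewrite valring_le1 /= leNgt.
    by apply/negP => wx; apply: nkx.
  have I1 : I 1.
    have Iyx : I (y *: x) by apply: (idealZ hT).
    rewrite -(subrK (y *: x) 1); case: (hI) => _ _ ID _.
    apply: ID => //; apply: kI.
    split.
      by apply: (subalg_subgroup hT).2; [exact: subalg1|exact: subalgZ].
    have -> : (1 - y *: x) c = 1 - (x c : O) * y.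
      by rewrite !ffunE [(x c : O) * y]mulrC.
    by rewrite xy subrr raddf0 (absval_eq0 _ _).2.
  by move=> t Tt; rewrite -(mulr1 t); case: hI => _ _ _; apply.
left; apply/seteqP; split=> // x Ix.
by apply: contrapT => nk; apply: nI; exists x.
Qed.

(** T has only one maximal ideal, so the kernels of reduction at all coordinates
    coincide. *)
Lemma local_coord_lt1 : complete_local T ->
  forall c c' t, T t -> w (val (t c : O)) < 1 -> w (val (t c' : O)) < 1.
Proof.
move=> [m [_ muniq _]] c c' t Tt wt.
have : coord_kernel c t by [].
rewrite (muniq _ (coord_kernel_maximal c)) -(muniq _ (coord_kernel_maximal c')).
by case.
Qed.

(** Taken over all coordinates, the left-hand side vanishes: t is a root of the
    polynomial with roots its own coordinates. Separating the constant term
    turns this into a formula for the inverse of t with q in T. *)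
Lemma prod_sub_coord t (s : seq 'I_d) : T t ->
  exists2 q, T q & \prod_(c <- s) (t - (t c : O) *: (1 : coord_alg O d)) =
    t * q + (\prod_(c <- s) (- (t c : O))) *: (1 : coord_alg O d).
Proof.
move=> Tt; elim: s => [|c s [q Tq IH]].
  by exists 0; [exact: subalg0|rewrite !big_nil scale1r mulr0 add0r].
pose u := \prod_(c <- s) - (t c : O).
exists ((t - (t c : O) *: (1 : coord_alg O d)) * q + u *: (1 : coord_alg O d)).
  apply: (subgroup_setD (subalg_subgroup hT)).
    2: exact/(subalgZ hT)/(subalg1 hT).
  apply: subalgM => //; apply: (subalg_subgroup hT).2 => //.
  exact/(subalgZ hT)/(subalg1 hT).
rewrite !big_cons IH -/u mulrDr mulrA (coord_mulC _ t) -mulrA.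
rewrite [in RHS]mulrDr -addrA; congr (_ + _).
by rewrite mulrBl coord_scale1Ml scalerA mulNr scaleNr.
Qed.

Lemma subalg_inv t : T t -> (forall c, w (val (t c : O)) = 1) ->
  exists2 u, T u & t * u = 1.
Proof.
move=> Tt t1; have [q Tq] := prod_sub_coord (index_enum 'I_d) Tt.
have -> :
    \prod_(c <- index_enum 'I_d) (t - (t c : O) *: (1 : coord_alg O d)) = 0.
  apply/ffunP => i.
  have morph (r : seq 'I_d) (F : 'I_d -> coord_alg O d) :
      (\prod_(c <- r) F c) i = \prod_(c <- r) (F c i : O) :> O.
    by elim/big_rec2: _ => [|c x y _ <-]; rewrite ffunE.
  have ti : (t - (t i : O) *: (1 : coord_alg O d)) i = 0 :> O.
    by rewrite coord_subE coord_scale1E subrr.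
  have zero (F : 'I_d -> O) : F i = 0 -> \prod_(c <- index_enum 'I_d) F c = 0.
    move=> F0; rewrite (bigD1_seq i) ?mem_index_enum ?index_enum_uniq//=.
    by rewrite F0 mul0r.
  rewrite morph [RHS]ffunE.
  exact: (zero (fun c => (t - (t c : O) *: (1 : coord_alg O d)) i)).
set e := \prod_(c <- _) - _; move=> eq0.
have [y ey] : exists y, e * y = 1.
  apply: valring_unit; rewrite /e rmorph_prod.
  elim/big_rec: _ => [|c x _ IH]; first exact: absval1.
  by rewrite absvalM IH mulr1 raddfN absvalN t1.
exists (- y *: q); first exact: subalgZ.
have {eq0} : t * q = - (e *: (1 : coord_alg O d)).
  by apply/eqP; rewrite -addr_eq0 -eq0.
move=> /ffunP tq; apply/ffunP => i; have := tq i.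
rewrite !(coord_mulE, coord_scaleE, ffunE) mulr1 => tqi.
by rewrite (mulrCA (t i : O)) tqi mulrNN mulrC.
Qed.

(** By locality one unit coordinate makes all coordinates units, and the inverse
    taken in O^d stays in T. *)
Lemma local_unit : complete_local T ->
  forall c t, T t -> w (val (t c : O)) = 1 -> exists2 u, T u & t * u = 1.
Proof.
move=> hloc c t Tt tc; apply: subalg_inv => // c'.
apply: le_anti; rewrite valring_le1 /= leNgt; apply/negP.
by move=> /(local_coord_lt1 hloc c Tt); rewrite tc ltxx.
Qed.

End ValuationSubalgebras.

Section LocalSubalgebras.
Set Implicit Arguments.
Unset Strict Implicit.
Variables (R : realType) (K : fieldType) (w : absval R K).
Local Notation O := (valring w).

Lemma subgroup_principal_ideal (pi : O) :
  subgroup_set (principal_ideal setT pi).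
Proof.
split; first by exists 0; rewrite // mul0r.
by move=> _ _ [x _ <-] [y _ <-]; exists (x - y); rewrite // mulrBl.
Qed.

(** The s elements are 0 and lifts of s - 1 distinct residue units: two
    elements of O are incongruent modulo pi exactly when their difference has
    absolute value 1. *)
Lemma residue_separated (pi : O) s : uniformizer pi -> (0 < s)%N ->
    `I_(s - 1) #<= quot_units [set: O] (principal_ideal setT pi) ->
  exists u : 'I_s -> O, forall i j, i != j -> w (val (u i - u j)) = 1.
Proof.
move=> hpi; case: s => [//|s] _; rewrite subn1 /= => /pcard_leP[f].
have lt1 (x : O) : w (val x) < 1 <-> principal_ideal setT pi x.
  split=> [/hpi[y ->]|[y _ <-]]; first by exists y; rewrite // mulrC.
  by apply/hpi; exists y; rewrite mulrC.
have eq1 (x : O) : ~ w (val x) < 1 -> w (val x) = 1.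
  by move=> /negP nx; apply: le_anti; rewrite valring_le1 leNgt.
have fP (i : 'I_s) : exists x : O, w (val x) = 1 /\
    coset (principal_ideal setT pi) x = f i.
  have : quot_units setT (principal_ideal setT pi) (f i) by apply: funS => /=.
  move=> [x [_ [y _ /lt1 xy]] <-]; exists x; split=> //; apply: eq1 => x1.
  have : w (val (x * y - (x * y - 1))) < 1.
    apply: valring_absvalB_lt => //; rewrite valring_absvalM.
    apply: le_lt_trans x1.
    by rewrite ler_piMr ?absval_ge0 ?valring_le1.
  by rewrite subKr rmorph1 absval1 ltxx.
have [x xP] := choice fP.
(* index 0 carries the residue 0, the other s - 1 indices carry the units *)
pose u i := if unlift ord0 i is Some k then x k else 0.
exists u => i j; rewrite /u.
case: unliftP => [k ->|->]; case: unliftP => [l ->|->]; rewrite ?eqxx// => ij.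
- rewrite -[LHS]/(w (val (x k - x l))); apply: eq1 => /lt1.
  move=> /(coset_eqP _ _ (subgroup_principal_ideal pi)).
  rewrite (xP k).2 (xP l).2 => /(@inj _ _ _ f) kl.
  move/eqP: ij; apply; congr lift; apply: val_inj.
  by apply: kl; rewrite inE /=.
- by rewrite -[LHS]/(w (val (x k - 0))) subr0 (xP k).1.
- by rewrite -[LHS]/(w (val (0 - x l))) sub0r raddfN absvalN (xP l).1.
Qed.

(** A vector space over F is not the union of s proper subspaces if F has at
    least s elements. Here the i-th subspace consists of the x in J whose
    absolute value at c i is not maximal. If x is good for the first k indices
    but not for the next one, i0, and y is good for i0, then y + u r x is good
    for i0 for all r, and each of the k earlier indices excludes at most one
    r: two bad values r, r' would make (u r - u r') x smaller than M i at c i,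
    while u r - u r' is a unit. As k < s, some r is left. *)
Lemma simultaneous_maximum d s (J : set (coord_alg O d)) (c : 'I_s -> 'I_d)
    (M : 'I_s -> R) (u : 'I_s -> O) :
    (forall x y, J x -> J y -> J (x + y)) ->
    (forall a x, J x -> J (a *: x)) -> J 0 ->
    (forall i x, J x -> w (val (x (c i) : O)) <= M i) ->
    (forall i, exists2 x, J x & w (val (x (c i) : O)) = M i) ->
    (forall i j, i != j -> w (val (u i - u j)) = 1) ->
  exists2 x, J x & forall i, w (val (x (c i) : O)) = M i.
Proof.
move=> JD JZ J0 Jle Jmax hu.
suff H k : (k <= s)%N ->
    exists2 x, J x & forall i : 'I_s, (i < k)%N -> w (val (x (c i) : O)) = M i.
  by have [x Jx xM] := H s (leqnn s); exists x => // i; apply: xM.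
elim: k => [_|k IHk ks]; first by exists 0.
have [x Jx xM] := IHk (ltnW ks); pose i0 := Ordinal ks.
have ltS (i : 'I_s) : (i < k.+1)%N -> (i < k)%N \/ i = i0.
  by rewrite ltnS leq_eqVlt => /orP[/eqP ik|]; [right; apply: val_inj|left].
have [xi0|/eqP xi0] := eqVneq (w (val (x (c i0) : O))) (M i0).
  by exists x => // i /ltS[/xM//|->].
have [y Jy yM] := Jmax i0.
pose wd : 'I_k -> 'I_s := widen_ord (ltnW ks).
pose val_at r i := w (val (y (c i) + u r * x (c i) : O)).
have [r rP] : exists r, forall i : 'I_k, val_at r (wd i) = M (wd i).
  apply: contrapT => /forallNP bad.
  (* b r is an earlier index that excludes r; b is not injective as k < s *)
  have /choice[b bP] : forall r, exists i, val_at r (wd i) <> M (wd i).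
    by move=> r; exact/existsNP.
  have : (s <= k)%N.
    rewrite -[s]card_ord -[k]card_ord; apply: (@leq_card _ _ b) => r r' brr'.
    apply: contrapT => /eqP/hu rr'.
    have := bP r; have := bP r'; rewrite brr' /val_at; set i := wd _.
    have blt q : w (val (y (c i) + u q * x (c i) : O)) <> M i ->
        w (val (y (c i) + u q * x (c i) : O)) < M i.
      move=> /eqP ne; rewrite lt_neqAle ne andTb.
      by rewrite -coord_scaleE -coord_addE; apply/Jle/JD/JZ.
    move=> /blt h' /blt h; have := valring_absvalB_lt h h'.
    rewrite opprD addrACA subrr add0r -mulrBl valring_absvalM.
    by rewrite rr' mul1r xM ?ltxx//=.
  by rewrite leqNgt ks.
exists (y + u r *: x); first exact/JD/JZ.
move=> i /ltS[ik|->].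
  have := rP (Ordinal ik); rewrite (_ : wd _ = i); last exact: val_inj.
  by rewrite coord_addE coord_scaleE.
rewrite coord_addE coord_scaleE; apply: le_anti; apply/andP; split.
  by rewrite -coord_scaleE -coord_addE; apply/Jle/JD/JZ.
rewrite leNgt; apply/negP => lt.
have xlt : w (val (u r * x (c i0) : O)) < M i0.
  rewrite valring_absvalM; apply: (@le_lt_trans _ _ (w (val (x (c i0) : O)))).
    by rewrite ler_piMl ?absval_ge0 ?valring_le1.
  by rewrite lt_neqAle Jle// andbT; apply/eqP.
by have := valring_absvalB_lt lt xlt; rewrite addrK yM ltxx.
Qed.

Section LocalAlgebra.
Variables (d : nat) (T : set (coord_alg O d)).
Hypothesis hT : is_subalgebra T.

(** By the pigeonhole principle two powers of pi are congruent modulo J; their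
    difference is a scalar in J, nonzero as their absolute values differ. *)
Lemma finite_index_regular (pi : O) J : uniformizer pi -> pi != 0 ->
    is_ideal T J -> finite_index T J ->
  exists2 x, J x & forall c, x c != 0 :> O.
Proof.
move=> hpi pi0 hJ Jfin; have sJ := ideal_subgroup hT hJ.
have [I [g [_ _ gc]]] := finite_quot_reps sJ Jfin.
have T1 k : T (pi ^+ k *: (1 : coord_alg O d)).
  exact/(subalgZ hT)/(subalg1 hT).
have /choice[h hP] := fun k => gc _ (T1 k).
have /injectivePn[a [b ab hab]] :
    ~~ injectiveb (fun i : 'I_(#|I|.+1) => h i).
  apply/negP => /injectiveP/leq_card; by rewrite card_ord ltnn.
exists ((pi ^+ a - pi ^+ b) *: (1 : coord_alg O d)).
  have := sJ.2 _ _ (hP a) (hP b).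
  by rewrite hab opprB addrA subrK -scalerBl.
move=> c; rewrite coord_scale1E subr_eq0.
apply: contra ab => /eqP/(congr1 (fun x => w (val x))).
rewrite !rmorphXn !absvalX => /ieexprIn abE; apply/eqP/val_inj/abE.
  by rewrite absval_gt0 valring_neq0.
by rewrite lt_eqF// uniformizer_lt1.
Qed.

(** An element of J of absolute value 1 at one coordinate is a unit of T, which
    forces J = T. Otherwise congruence of scalars modulo J implies congruence
    modulo the maximal ideal of O, so the coordinates of representatives of
    T/J exhaust the residue field. *)
Lemma finite_index_residue_cover J : complete_local T ->
    is_ideal T J -> finite_index T J -> J <> T -> (0 < d)%N ->
  exists (I : finType) (l : I -> O), forall x, exists i, w (val (x - l i)) < 1.
Proof.
move=> hloc hJ Jfin JT d0; have sJ := ideal_subgroup hT hJ.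
have [I [g [_ _ gc]]] := finite_quot_reps sJ Jfin.
pose c := Ordinal d0; exists I, (fun i => g i c) => x.
have [i Ji] := gc _ (subalgZ hT x (subalg1 hT)); exists i.
rewrite ltNge; apply/negP => x1; apply: JT.
case: (hJ) => JT _ _ JM; have Ti := JT _ Ji.
have [|y Ty xy1] := local_unit hT hloc (c := c) Ti.
  apply: le_anti; rewrite valring_le1 /=; apply: le_trans x1 _.
  by rewrite coord_subE coord_scale1E.
apply/seteqP; split=> // t Tt.
rewrite -(mulr1 t) -xy1 (coord_mulC _ y) mulrA.
by apply: JM => //; apply: (subalgM hT).
Qed.

End LocalAlgebra.
End LocalSubalgebras.

(** * Projections to the blocks *)

Section Blocks.
Set Implicit Arguments.
Unset Strict Implicit.
Variables (R : realType) (K : fieldType) (w : absval R K).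
Local Notation O := (valring w).
Variables (s : nat) (n : 'I_s -> nat).
Local Notation A := (coord_alg O (\sum_(i < s) n i)).

Lemma block_projM i (x y : A) :
  block_proj i (x * y) = block_proj i x * block_proj i y.
Proof. by apply/ffunP => k; rewrite !ffunE. Qed.

Lemma block_projB i (x y : A) :
  block_proj i (x - y) = block_proj i x - block_proj i y.
Proof. by apply/ffunP => k; rewrite !ffunE. Qed.

Lemma block_proj1 i : block_proj i (1 : A) = 1.
Proof. by apply/ffunP => k; rewrite !ffunE. Qed.

Lemma block_proj_inj (x y : A) :
  (forall i, block_proj i x = block_proj i y) -> x = y.
Proof.
move=> xy; apply/ffunP => c; rewrite -(tagnat.sig2K c).
by have /ffunP/(_ (tagnat.sig2 c)) := xy (tagnat.sig1 c); rewrite !ffunE.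
Qed.

Lemma block_proj_glue (t : 'I_s -> A) :
  exists z : A, forall i, block_proj i z = block_proj i (t i).
Proof.
exists [ffun c => t (tagnat.sig1 c) c] => i.
by apply/ffunP => k; rewrite !ffunE tagnat.Rank1K.
Qed.

Lemma block_proj_subgroup i (G : set A) :
  subgroup_set G -> subgroup_set (block_proj i @` G).
Proof.
move=> [G0 GB]; split.
  by exists 0 => //; apply/ffunP => k; rewrite !ffunE.
move=> _ _ [x Gx <-] [y Gy <-].
by exists (x - y); [exact: GB|rewrite block_projB].
Qed.

(** The product of the projections of T, inside O^(n_0 + ... + n_(s-1)). *)
Definition block_hull (T : set A) : set A :=
  [set x | forall i, (block_proj i @` T) (block_proj i x)].

Lemma block_hull_subgroup T : subgroup_set T -> subgroup_set (block_hull T).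
Proof.
move=> sT; split=> [i|x y Bx By i]; first by exists 0; rewrite //; exact: sT.1.
by rewrite block_projB; apply: (block_proj_subgroup i sT).2.
Qed.

Lemma block_hull_mul T (a : A) : is_subalgebra T -> T a ->
  *%R a @` block_hull T `<=` block_hull T.
Proof.
move=> hT Ta _ [x Bx <-] i; have [t Tt tx] := Bx i.
by exists (a * t); [exact: (subalgM hT)|rewrite !block_projM tx].
Qed.

(** The part of B/aB = prod_i T_i/J_i that is needed: two elements of B that are
    congruent modulo J_i in every block are congruent modulo aB. *)
Lemma mem_mul_block_hull T (J : set A) (a x : A) :
    (forall i, block_proj i @` J `<=` block_proj i @` ( *%R a @` T)) ->
    (forall i, (block_proj i @` J) (block_proj i x)) ->
  ( *%R a @` block_hull T) x.
Proof.
move=> Ja Jx.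
have tP i : exists t, T t /\ block_proj i (a * t) = block_proj i x.
  by have [_ [t Tt <-] <-] := Ja i _ (Jx i); exists t.
have [t {}tP] := choice tP; have [z zP] := block_proj_glue t.
exists z; first by move=> i; rewrite zP; exists (t i) => //; case: (tP i).
by apply: block_proj_inj => i; rewrite block_projM zP -block_projM (tP i).2.
Qed.

(** Here l lists representatives of the residue field. All indices are finite
    because the subgroups involved contain aT, which contains e a O^n for a
    scalar e with e O^n inside T. The equality [T : aT] = [B : aB] then matches
    representatives of T/aT, which cover T/J, with representatives of B/aB,
    which stay distinct in the product of the T_i/J_i. *)
Lemma quot_card_le (pi : O) (I : finType) (l : I -> O) (T J : set A) (a : A) :
    uniformizer pi -> (forall x, exists i, w (val (x - l i)) < 1) ->
    is_subalgebra T -> full_rank T -> is_ideal T J -> J a ->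
    (forall c, a c != 0 :> O) ->
    (forall i, block_proj i @` J `<=` block_proj i @` ( *%R a @` T)) ->
  quot T J #<= [set C : forall i : 'I_s, set (coord_alg O (n i)) |
      forall i, quot (block_proj i @` T) (block_proj i @` J) (C i)].
Proof.
move=> hpi hl hT hrank hJ Ja a0 Jgen.
have [JT _ _ JM] := hJ; have Ta := JT _ Ja.
have sT := subalg_subgroup hT; have sJ := ideal_subgroup hT hJ.
have sB := block_hull_subgroup sT.
have TB : T `<=` block_hull T by move=> t Tt i; exists t.
have aB : {morph *%R a : x y / x - y} by move=> x y; rewrite mulrBr.
have ainj : injective ( *%R a) by apply: coord_mulI.
have aTT : *%R a @` T `<=` T by move=> _ [t Tt <-]; exact: (subalgM hT).
have aTJ : *%R a @` T `<=` J.
  by move=> _ [t Tt <-]; rewrite coord_mulC; apply: JM.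
have aBB := block_hull_mul hT Ta.
have [e e0 eT] := full_rank_conductor hT hrank.
pose ea : A := e *: a.
have [X [f fc]] : exists (X : finType) (f : X -> A),
    forall x, exists i, ( *%R a @` T) (x - f i).
  have [|X [f fc]] := coord_cover (e := ea) hpi hl.
    by move=> c; rewrite coord_scaleE valring_mulf_neq0.
  exists X, f => x; have [i [y xy]] := fc x; exists i.
  exists (e *: y) => //; rewrite xy.
  rewrite /ea; apply/ffunP => c.
  by rewrite !(coord_mulE, coord_scaleE) mulrCA mulrA.
have reps (G H : set A) : subgroup_set H -> *%R a @` T `<=` H ->
    exists (Y : finType) (g : Y -> A), coset_reps G H g.
  move=> sH aTH; apply: finite_quot_reps => //.
  apply: (cover_finite_quot (f := f)) => // x _.
  by have [i /aTH] := fc x; exists i.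
have sa G : subgroup_set G -> subgroup_set ( *%R a @` G).
  move=> [G0 GB]; split; first by exists 0; rewrite ?mulr0.
  by move=> _ _ [x Gx <-] [y Gy <-]; exists (x - y); [exact: GB|exact: aB].
have [X1 [f1 r1]] := reps (block_hull T) T sT aTT.
have [X2 [f2 r2]] := reps T _ (sa _ sT) (fun _ => id).
have [X3 [f3 r3]] := reps (block_hull T) _ (sa _ sB) (image_subset _ TB).
have X23 := index_mul_stable ainj aB sT sB TB aTT aBB r1 r2 r3.
have [_ f3sep _] := r3; have [f3B _ _] := r3; have [_ _ f2c] := r2.
pose h (k : X2) : X3 := enum_val (cast_ord X23 (enum_rank k)).
have hinj : injective h.
  by move=> k k' /enum_val_inj/cast_ord_inj/enum_rank_inj.
pose g k i := coset (block_proj i @` J) (block_proj i (f3 (h k))).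
apply: (@card_le_through X2 _ _ _ _ (fun k => coset J (f2 k)) g).
- move=> _ [x Tx <-]; have [k /aTJ] := f2c _ Tx.
  by exists k => //; apply/esym/coset_eqP.
- move=> k k' gkk'; apply/hinj/f3sep.
  apply: (mem_mul_block_hull Jgen) => i; rewrite block_projB.
  apply/(coset_eqP _ _ (block_proj_subgroup i sJ)).
  exact: (congr1 (fun C => C i) gkk').
- by move=> k i; exists (block_proj i (f3 (h k))) => //; exact: f3B.
Qed.

(** For x in J write phi_i(x) = phi_i(t b_i), where b_i in J projects to a
    generator of phi_i(J). The absolute value of x at a coordinate c i of block
    i is at most that of b_i, and if they agree then t is a unit at c i, hence a
    unit of T by locality, so phi_i(x) generates phi_i(J). An a that attains the
    maximum in all blocks therefore generates all the phi_i(J). *)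
Lemma simultaneous_generator (u : 'I_s -> O) (T J : set A) :
    (forall i j, i != j -> w (val (u i - u j)) = 1) ->
    (forall i, (0 < n i)%N) -> is_subalgebra T -> complete_local T ->
    is_ideal T J -> (exists2 x, J x & forall c, x c != 0 :> O) ->
    (forall i, is_principal (block_proj i @` T) (block_proj i @` J)) ->
  exists a, [/\ J a, forall c, a c != 0 :> O
    & forall i, block_proj i @` J `<=` block_proj i @` ( *%R a @` T)].
Proof.
move=> hu hn hT hloc hJ [x Jx x0] princ.
have sJ := ideal_subgroup hT hJ; have [JT _ _ JM] := hJ.
have /choice[b bP] : forall i, exists b, J b /\ forall y, J y ->
    exists2 t, T t & block_proj i y = block_proj i (t * b).
  move=> i; have [_ [a Ta <-] Jia] := princ i.
  have : (block_proj i @` J) (block_proj i a).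
    rewrite Jia; exists 1; last by rewrite mul1r.
    by exists 1; [exact: (subalg1 hT)|exact: block_proj1].
  move=> [b Jb ba]; exists b; split=> // y Jy.
  have : (block_proj i @` J) (block_proj i y) by exists y.
  rewrite Jia => -[_ [t Tt <-] <-]; exists t => //.
  by rewrite block_projM ba.
have coordE i k (y z : A) : block_proj i y = block_proj i z ->
    y (tagnat.Rank i k) = z (tagnat.Rank i k).
  by move=> /ffunP/(_ k); rewrite !ffunE.
have b0 i k : b i (tagnat.Rank i k) != 0 :> O.
  have [t _ /(coordE _ k) xE] := (bP i).2 _ Jx.
  apply/eqP => bk0; have := x0 (tagnat.Rank i k).
  by rewrite xE coord_mulE bk0 mulr0 eqxx.
pose c i := tagnat.Rank i (Ordinal (hn i)).
have [|||i y Jy|i||a Ja aM] := @simultaneous_maximum _ _ w _ s J c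
    (fun i => w (val (b i (c i) : O))) u.
- by case: hJ.
- by move=> e y; exact: (idealZ hT).
- by case: hJ.
- have [t Tt /(coordE _ (Ordinal (hn i))) ->] := (bP i).2 _ Jy.
  by rewrite coord_mulE valring_absvalM ler_piMl ?absval_ge0 ?valring_le1.
- by exists (b i) => //; case: (bP i).
- exact: hu.
have /choice[t tP] : forall i, exists t, [/\ T t,
    block_proj i a = block_proj i (t * b i) & exists2 v, T v & t * v = 1].
  move=> i; have [t Tt aE] := (bP i).2 _ Ja; exists t; split=> //.
  apply: (local_unit hT hloc (c := c i)) => //.
  have := aM i; rewrite (coordE _ (Ordinal (hn i)) _ _ aE) coord_mulE.
  rewrite valring_absvalM -[RHS]mul1r => /mulIf; apply.
  by rewrite gt_eqF// absval_gt0 valring_neq0.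
exists a; split=> // [k|i _ [y Jy <-]].
  rewrite -(tagnat.sig2K k); set i := tagnat.sig1 k.
  have [_ /coordE -> [v _ tv]] := tP i.
  rewrite coord_mulE valring_mulf_neq0//.
  apply/eqP => t0; have /ffunP/(_ (tagnat.Rank i (tagnat.sig2 k))) := tv.
  rewrite coord_mulE t0 mul0r ffunE => /eqP; by rewrite eq_sym oner_eq0.
have [_ aE [v Tv tv]] := tP i; have [r Tr yE] := (bP i).2 _ Jy.
exists (a * (r * v)); first by exists (r * v) => //; exact: (subalgM hT).
rewrite yE (coord_mulC a) !block_projM aE -!block_projM.
by rewrite -mulrA (mulrA v) (coord_mulC v) tv mul1r.
Qed.

End Blocks.

Theorem theorem2p1 (R : realType) (p : nat) (hp : prime p)
  (Qp : fieldType) (v : absval R Qp) (hQp : is_padic_field p v)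
  (E : fieldExtType Qp) (w : absval R E) (hw : absval_extends v w)
  (pi : valring w) (hpi : uniformizer pi)
  (s : nat) (hs : (0 < s)%N) (n : 'I_s -> nat) (hn : forall i, (0 < n i)%N)
  (T : set (coord_alg (valring w) (\sum_(i < s) n i)))
  (hTalg : is_subalgebra T) (hTloc : complete_local T) (hTrank : full_rank T)
  (J : set (coord_alg (valring w) (\sum_(i < s) n i)))
  (hJ : is_ideal T J) (hJfin : finite_index T J)
  (hF : `I_(s - 1) #<= quot_units [set: valring w] (principal_ideal setT pi))
  (hJprinc : forall i : 'I_s,
     is_principal (block_proj i @` T) (block_proj i @` J)) :
  quot T J #<=
    [set C : forall i : 'I_s, set (coord_alg (valring w) (n i)) |
      forall i, quot (block_proj i @` T) (block_proj i @` J) (C i)].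
Proof.
have [JT|/eqP JT] := eqVneq J T.
  apply: (@card_le_through unit _ _ _ _ (fun=> coset J 0)
    (fun _ i => coset (block_proj i @` J) (block_proj i 0))).
  - move=> _ [x Tx <-]; exists tt => //.
    apply/coset_eqP; first exact: (ideal_subgroup hTalg hJ).
    by rewrite sub0r JT; apply: (subgroup_setN (subalg_subgroup hTalg)).
  - by move=> [] [].
  - move=> _ i; exists (block_proj i 0) => //.
    by exists 0 => //; exact: (subalg0 hTalg).
have d0 : (0 < \sum_(i < s) n i)%N.
  by rewrite (bigD1 (Ordinal hs))//= addn_gt0 hn.
have pi0 := padic_uniformizer_neq0 hp hQp hw hpi.
have [I [l hl]] := finite_index_residue_cover hTalg hTloc hJ hJfin JT d0.
have [u hu] := residue_separated hpi hs hF.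
have reg := finite_index_regular hTalg hpi pi0 hJ hJfin.
have [a [Ja a0 aJ]] := simultaneous_generator hu hn hTalg hTloc hJ reg hJprinc.
exact: quot_card_le hpi hl hTalg hTrank hJ Ja a0 aJ.
Qed.
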